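(* Let $(\Omega,\mathcal{F})$ be a measurable space, let $\mathcal{P}=\{P_1,\dots,P_K\}$ be a finite set of probability measures on it, and let $X$ be a real random variable with $\max_{1\le i\le K}E_{P_i}[X^2]<\infty$. Put $\mu_i=E_{P_i}[X]$ and $\kappa_i=E_{P_i}[X^2]$ for $1\le i\le K$, and suppose the measures are indexed so that $\mu_1\le\mu_2\le\cdots\le\mu_K$. Then the upper variance of $X$ under $\mathcal{P}$ is $$\overline{V}(X)=\max\left\{\max_{1\leq i\leq K}(\kappa_i-\mu_i^2),\ \max_{1\leq i<j\leq K}h_{ij}(\mu_{ij})\right\},$$ where, for $1\le i<j\le K$, $h_{ij}(x)=x^2-2\mu_i x+\kappa_i$ and $$\mu_{ij}=\begin{cases}\left(\mu_i\vee\dfrac{\kappa_j-\kappa_i}{2(\mu_j-\mu_i)}\right)\wedge\mu_j, & \mu_i<\mu_j,\\[2mm] \mu_i, & \mu_i=\mu_j.\end{cases}$$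
   Context: The upper variance of $X$ under $\mathcal{P}=\{P_1,\dots,P_K\}$ is $\overline{V}(X)=\min_{\mu\in M_X}\max_{1\le i\le K}E_{P_i}[(X-\mu)^2]$, where $M_X=[\min_{i}E_{P_i}[X],\ \max_{i}E_{P_i}[X]]$ (the minimum over $\mu\in\mathbb{R}$ gives the same value). Notation: $a\vee b=\max\{a,b\}$, $a\wedge b=\min\{a,b\}$. A maximum over an empty index set (the case $K=1$) is taken to be $-\infty$. *)

(* Defs.v *)
From HB Require Import structures.
From mathcomp Require Import all_boot all_order all_algebra.
From mathcomp Require Import all_classical all_reals all_analysis.

Set Implicit Arguments.
Unset Strict Implicit.
Unset Printing Implicit Defensive.

Import Order.TTheory GRing.Theory Num.Theory.

Local Open Scope classical_set_scope.
Local Open Scope ring_scope.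
Local Open Scope ereal_scope.

Section UpperVariance.
Context {d : measure_display} {T : measurableType d} {R : realType} {K : nat}.
Variables (P : 'I_K -> probability T R) (X : {mfun T >-> R}).

Definition mean_interval : set R :=
  [set m : R | \big[mine/+oo]_(i < K) 'E_(P i)[X] <= m%:E /\
               m%:E <= \big[maxe/-oo]_(i < K) 'E_(P i)[X]].

Definition max_sq_deviation (m : R) : \bar R :=
  \big[maxe/-oo]_(i < K) 'E_(P i)[fun w => ((X w - m) ^+ 2)%R].

Definition is_minimum (S : set (\bar R)) (v : \bar R) : Prop :=
  S v /\ lbound S v.

(* A relation rather than an infimum: asserting it includes the existence of a
   minimizer in the definition of the upper variance. *)
Definition is_upper_variance (v : \bar R) : Prop :=
  is_minimum (max_sq_deviation @` mean_interval) v.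

(* fine sends infinite expectations to 0; both moments are finite whenever the
   second moment is. *)
Definition mean (i : 'I_K) : R := fine 'E_(P i)[X].

Definition second_moment (i : 'I_K) : R :=
  fine 'E_(P i)[fun w => (X w ^+ 2)%R].

Definition pair_quad (i j : 'I_K) (x : R) : R :=
  (x ^+ 2 - 2 * mean i * x + second_moment i)%R.

Definition pair_mean (i j : 'I_K) : R :=
  (if mean i < mean j then
     Num.min
       (Num.max (mean i)
          ((second_moment j - second_moment i) / (2 * (mean j - mean i))))
       (mean j)
   else mean i)%R.

End UpperVariance.

(* Main.v *)
Require Import Defs.
From HB Require Import structures.
From mathcomp Require Import all_boot all_order all_algebra.
From mathcomp Require Import all_classical all_reals all_analysis.
From mathcomp Require Import measurable_realfun ring lra.

Import Order.TTheory GRing.Theory Num.Theory.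

Local Open Scope classical_set_scope.
Local Open Scope ring_scope.
Local Open Scope ereal_scope.

(** Once the two moments of [X] under each [P_i] are known to be finite,
    [E_i (X - x)^2 = x^2 - 2 mu_i x + kappa_i =: q_i x], a parabola with vertex
    [(mu_i, kappa_i - mu_i^2)].  The upper variance is therefore the minimum over
    [[mu_1, mu_K]] of the upper envelope of finitely many translates of [x^2].

    Two such parabolas meet exactly once when their vertices have different
    abscissas, and [mu_ij] is that meeting point clamped to [[mu_i, mu_j]]: it is
    where [max q_i q_j] is smallest.  So the right-hand side [v] of the formula is
    the largest minimum over all single parabolas and all pairs, and it bounds the
    envelope from below at every point
    ([quad_crossing_le_max] and the vertex bound [vertex_le_quad]).

    That [v] is attained is Helly's theorem on the line.  The sublevel set
    [q_i <= v] is an interval centred at [mu_i], nonempty as [v] dominates every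
    vertex value.  Any two of these intervals meet, since [mu_ij] belongs to both
    ([quad_crossing_le_vertex] supplies the half that is not immediate), and each
    contains its centre, a point of [[mu_1, mu_K]].  Pairwise intersection on the
    line gives a common point, which lies in [[mu_1, mu_K]]
    ([sublevels_common_point]); there every [q_i] is at most [v]. *)

(** * Parabolas with unit leading coefficient *)

Section Parabolas.
Context {R : realType}.
Implicit Types m k x v : R.

Definition quad m k x : R := (x ^+ 2 - 2 * m * x + k)%R.

Definition crossing m1 k1 m2 k2 : R :=
  (if m1 < m2 then
     Num.min (Num.max m1 ((k2 - k1) / (2 * (m2 - m1)))) m2
   else m1)%R.

Lemma quad_vertex m k : quad m k m = (k - m ^+ 2)%R.
Proof. by rewrite /quad; ring. Qed.

Lemma vertex_le_quad m k x : (k - m ^+ 2 <= quad m k x)%R.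
Proof. by rewrite /quad; have := sqr_ge0 (x - m); lra. Qed.

Lemma quad_le_right m k x y : (m <= x -> x <= y -> quad m k x <= quad m k y)%R.
Proof.
move=> mx xy; have : (0 <= (y - x) * ((x - m) + (y - m)))%R.
  by rewrite mulr_ge0//; lra.
by rewrite /quad; lra.
Qed.

Lemma quad_le_left m k x y : (x <= y -> y <= m -> quad m k y <= quad m k x)%R.
Proof.
move=> xy ym; have : (0 <= (y - x) * ((m - x) + (m - y)))%R.
  by rewrite mulr_ge0//; lra.
by rewrite /quad; lra.
Qed.

(** The difference of the two parabolas is affine with slope [2 (m2 - m1)], so
    its sign is decided by the side of the meeting point. *)
Lemma quad_le_quad m1 k1 m2 k2 x : (m1 < m2)%R ->
  (quad m1 k1 x <= quad m2 k2 x)%R = (x <= (k2 - k1) / (2 * (m2 - m1)))%R.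
Proof.
move=> m12; rewrite ler_pdivlMr; last by lra.
by rewrite /quad; apply/idP/idP => ?; lra.
Qed.

Variant crossing_spec m1 k1 m2 k2 : R -> Prop :=
| CrossingLeft : (quad m2 k2 m1 <= quad m1 k1 m1)%R ->
    crossing_spec m1 k1 m2 k2 m1
| CrossingMid c : (m1 <= c <= m2)%R -> quad m1 k1 c = quad m2 k2 c ->
    crossing_spec m1 k1 m2 k2 c
| CrossingRight : (quad m1 k1 m2 <= quad m2 k2 m2)%R ->
    crossing_spec m1 k1 m2 k2 m2.

(** All that the minimax argument needs to know about the clamping.  Parabolas
    with the same vertex abscissa are nested, so this degenerate case fits the
    left or the right one according to which parabola is on top. *)
Lemma crossingP m1 k1 m2 k2 : (m1 <= m2)%R ->
  crossing_spec m1 k1 m2 k2 (crossing m1 k1 m2 k2).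
Proof.
rewrite le_eqVlt /crossing => /predU1P[<-|m12].
  rewrite ltxx; case: (leP (quad m1 k2 m1) (quad m1 k1 m1)) => [?|/ltW ?].
    exact: CrossingLeft.
  exact: CrossingRight.
rewrite m12; set c := ((_ - _) / _)%R.
have le12 x : (quad m1 k1 x <= quad m2 k2 x)%R = (x <= c)%R.
  exact: quad_le_quad.
have [cm1|m1c] := leP c m1.
  rewrite min_l ?(ltW m12)//; apply: CrossingLeft.
  by move: cm1; rewrite ler_pdivrMr /quad; lra.
have [cm2|m2c] := leP c m2; last by apply: CrossingRight; rewrite le12 ltW.
apply: CrossingMid; first by rewrite (ltW m1c) cm2.
have : (c * (2 * (m2 - m1)) = k2 - k1)%R by rewrite divfK//; apply: lt0r_neq0; lra.
by rewrite /quad; lra.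
Qed.

(** At a meeting point between the vertices, the second parabola decreases on
    the left and the first increases on the right, so no [x] does better on both.
    At a crossing clamped to a vertex, the first parabola is either at its own
    minimum or below the minimum of the second. *)
Lemma quad_crossing_le_max m1 k1 m2 k2 x : (m1 <= m2)%R ->
  (quad m1 k1 (crossing m1 k1 m2 k2) <=
   Num.max (quad m1 k1 x) (quad m2 k2 x))%R.
Proof.
move=> m12; rewrite le_max; case: crossingP => // [_|c /andP[m1c cm2] e|q12].
- by rewrite quad_vertex vertex_le_quad.
- have [xc|cx] := leP x c.
    by apply/orP; right; rewrite e quad_le_left.
  by rewrite quad_le_right// ltW.
- by apply/orP; right; rewrite (le_trans q12)// quad_vertex vertex_le_quad.
Qed.

(** The asymmetry comes from evaluating the first parabola at the crossing: it is
    strictly the lower one there only if the crossing is [m2], where the second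
    parabola takes its vertex value. *)
Lemma quad_crossing_le_vertex m1 k1 m2 k2 : (m1 <= m2)%R ->
  (quad m2 k2 (crossing m1 k1 m2 k2) <=
   Num.max (quad m1 k1 (crossing m1 k1 m2 k2)) (k2 - m2 ^+ 2))%R.
Proof.
move=> m12; rewrite le_max; case: crossingP => // [->//|c _ ->|_].
  by rewrite lexx.
by rewrite quad_vertex lexx orbT.
Qed.

Lemma quad_sublevelE m k v x : (k - m ^+ 2 <= v)%R ->
  (quad m k x <= v)%R =
  (m - Num.sqrt (v - (k - m ^+ 2)) <= x <= m + Num.sqrt (v - (k - m ^+ 2)))%R.
Proof.
move=> kv; set r := Num.sqrt _.
have -> : (quad m k x <= v)%R = ((x - m) ^+ 2 <= v - (k - m ^+ 2))%R.
  by rewrite /quad; apply/idP/idP => ?; lra.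
rewrite -ler_distl -[in RHS]ler_sqr ?nnegrE// ?sqrtr_ge0//.
by rewrite real_normK ?num_real// sqr_sqrtr// subr_ge0.
Qed.

(** * Helly's theorem on the line *)

(** The largest left endpoint works.  The interval [[a, b]] takes part as a
    further member of the family. *)
Lemma helly_itv (I : finType) (l u : I -> R) (a b : R) : (a <= b)%R ->
  (forall i, a <= u i)%R -> (forall i, l i <= b)%R ->
  (forall i j, l i <= u j)%R ->
  exists2 x, (a <= x <= b)%R & forall i, (l i <= x <= u i)%R.
Proof.
move=> ab au lb lu; exists (\big[Num.max/a]_i l i).
  by rewrite bigmax_ge_id; apply/bigmax_leP.
by move=> i; rewrite le_bigmax; apply/bigmax_leP.
Qed.

Lemma sublevels_common_point {K : nat} (m k : 'I_K -> R) (v a b : R) :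
  (a <= b)%R -> (forall i, a <= m i <= b)%R ->
  (forall i j : 'I_K, (i <= j)%N -> (m i <= m j)%R) ->
  (forall i, k i - m i ^+ 2 <= v)%R ->
  (forall i j : 'I_K, (i < j)%N ->
     quad (m i) (k i) (crossing (m i) (k i) (m j) (k j)) <= v)%R ->
  exists2 x, (a <= x <= b)%R & forall i, (quad (m i) (k i) x <= v)%R.
Proof.
move=> ab amb m_homo varv crossv.
pose r i := Num.sqrt (v - (k i - m i ^+ 2)).
have r0 i : (0 <= r i)%R by exact: sqrtr_ge0.
have subE i x : (quad (m i) (k i) x <= v)%R = (m i - r i <= x <= m i + r i)%R.
  exact: quad_sublevelE.
have meet (i j : 'I_K) : (i < j)%N -> exists2 x,
    (m i - r i <= x <= m i + r i)%R & (m j - r j <= x <= m j + r j)%R.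
  move=> ij; have mij := m_homo _ _ (ltnW ij).
  exists (crossing (m i) (k i) (m j) (k j)); rewrite -subE; first exact: crossv.
  by rewrite (le_trans (quad_crossing_le_vertex _ _ _ _ mij))// ge_max crossv/=.
have [|||x xab xP] := @helly_itv _ (fun i => m i - r i)%R
    (fun i => m i + r i)%R a b ab.
- by move=> i; have := amb i; have := r0 i; lra.
- by move=> i; have := amb i; have := r0 i; lra.
- move=> i j; have [ij|ji|/val_inj ->] := ltngtP i j.
  + by have [x] := meet _ _ ij; lra.
  + by have [x] := meet _ _ ji; lra.
  + by have := r0 j; lra.
by exists x => // i; rewrite subE.
Qed.

End Parabolas.

(** * Moments *)

Section Moments.
Context {d : measure_display} {T : measurableType d} {R : realType}.
Variables (Q : probability T R) (X : {mfun T >-> R}).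
Hypothesis X2_fin : 'E_Q[fun w => (X w ^+ 2)%R] < +oo.

Lemma sqr_Lfun1 : (fun w => (X w ^+ 2)%R) \in Lfun Q 1.
Proof.
apply/Lfun1_integrable/integrableP; split.
  by apply/measurable_EFinP; exact: measurable_funX.
rewrite (eq_integral (fun w => (X w ^+ 2)%:E)).
  by move: X2_fin; rewrite unlock.
by move=> w _ /=; rewrite ger0_norm// sqr_ge0.
Qed.

(** Domination by [1 + X^2], which is integrable as [Q] is finite. *)
Lemma Lfun1_of_sqr : (X : T -> R) \in Lfun Q 1.
Proof.
have /Lfun1_integrable dom : (cst 1%R \+ (fun w => (X w ^+ 2)%R))%R \in Lfun Q 1.
  by rewrite rpredD ?Lfun_cst ?sqr_Lfun1.
apply/Lfun1_integrable; apply: le_integrable dom => //.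
  exact/measurable_EFinP.
move=> w _ /=; rewrite lee_fin [leRHS]ger0_norm; last by rewrite addr_ge0// sqr_ge0.
by rewrite -real_normK ?num_real//; have := sqr_ge0 (`|X w| - 1)%R; nra.
Qed.

Lemma expectation_sqr_dev (x : R) :
  'E_Q[fun w => ((X w - x) ^+ 2)%R] =
  (quad (fine 'E_Q[X]) (fine 'E_Q[fun w => (X w ^+ 2)%R]) x)%:E.
Proof.
have X1 := Lfun1_of_sqr; have X2 := sqr_Lfun1.
have -> : (fun w => ((X w - x) ^+ 2)%R) =
    (((fun w => (X w ^+ 2)%R) \- ((2 * x)%R \o* X)) \+ cst (x ^+ 2)%R)%R.
  by apply/funext => w /=; ring.
rewrite expectationD ?expectationB ?rpredB ?Lfun_scale ?Lfun_cst//.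
rewrite expectationZl// expectation_cst.
rewrite -(fineK (expectation_fin_num X1)) -(fineK (expectation_fin_num X2)) /=.
by congr EFin; rewrite /quad; ring.
Qed.

End Moments.

(** * The formula *)

Theorem theorem3p3 (d : measure_display) (T : measurableType d) (R : realType)
    (K : nat) (P : 'I_K -> probability T R) (X : {mfun T >-> R})
    (K_gt0 : (0 < K)%N)
    (X2_fin : \big[maxe/-oo]_(i < K) 'E_(P i)[fun w => (X w ^+ 2)%R] < +oo)
    (mean_sorted : forall i j : 'I_K, (i <= j)%N -> (mean P X i <= mean P X j)%R) :
  is_upper_variance P X
    (maxe
       (\big[maxe/-oo]_(i < K) (second_moment P X i - mean P X i ^+ 2)%:E)
       (\big[maxe/-oo]_(p : 'I_K * 'I_K | (p.1 < p.2)%N)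
          (pair_quad P X p.1 p.2 (pair_mean P X p.1 p.2))%:E)).
Proof.
pose m := mean P X; pose k := second_moment P X.
have X2 i : 'E_(P i)[fun w => (X w ^+ 2)%R] < +oo.
  by move/bigmax_ltP : X2_fin => [_]; exact.
have meanE i : 'E_(P i)[X] = (m i)%:E.
  by rewrite /m /mean fineK// expectation_fin_num// Lfun1_of_sqr.
have devE x : max_sq_deviation P X x = \big[maxe/-oo]_(i < K) (quad (m i) (k i) x)%:E.
  by apply: eq_bigr => i _; exact: expectation_sqr_dev.
set V := maxe _ _.
have varV i : (k i - m i ^+ 2)%:E <= V.
  by rewrite le_max; apply/orP; left; exact: le_bigmax.
have crossV (i j : 'I_K) : (i < j)%N ->
    (quad (m i) (k i) (crossing (m i) (k i) (m j) (k j)))%:E <= V.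
  move=> ij; rewrite le_max; apply/orP; right.
  exact: (@le_bigmax_cond _ _ _ _ (i, j) (fun p => p.1 < p.2)%N
    (fun p => (pair_quad P X p.1 p.2 (pair_mean P X p.1 p.2))%:E)).
have V_le x : V <= max_sq_deviation P X x.
  rewrite devE.
  have le_dev i : (quad (m i) (k i) x)%:E <= \big[maxe/-oo]_(i < K) (quad (m i) (k i) x)%:E.
    exact: le_bigmax.
  rewrite ge_max; apply/andP; split; apply/bigmax_leP; split; rewrite ?leNye//.
    by move=> i _; apply: le_trans (le_dev i); rewrite lee_fin vertex_le_quad.
  move=> [i j] /= ij.
  have := quad_crossing_le_max (m i) (k i) (m j) (k j) x (mean_sorted _ _ (ltnW ij)).
  by rewrite le_max => /orP[] h; [apply: le_trans (le_dev i)|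
    apply: le_trans (le_dev j)]; rewrite lee_fin.
split; last by move=> _ [x _ <-].
pose i0 := Ordinal K_gt0.
have VE : V = (fine V)%:E.
  rewrite fineK// fin_numElt (lt_le_trans (ltNyr _) (varV i0))/=.
  rewrite (le_lt_trans (V_le 0%R))// devE; apply/bigmax_ltP; split => // i _.
  exact: ltry.
have lt_last : (K.-1 < K)%N by rewrite ltn_predL.
pose i1 := Ordinal lt_last.
have m01 i : (m i0 <= m i <= m i1)%R.
  by rewrite !mean_sorted//= -ltnS prednK.
have [|||||x /andP[ax xb] xV] := @sublevels_common_point _ _ m k (fine V) (m i0) (m i1).
- by have /andP[] := m01 i1.
- exact: m01.
- exact: mean_sorted.
- by move=> i; rewrite -lee_fin -VE.
- by move=> i j ij; rewrite -lee_fin -VE crossV.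
exists x.
  split; under eq_bigr do rewrite meanE.
    by apply: (@le_trans _ _ (m i0)%:E); [exact: bigmin_le | rewrite lee_fin].
  by apply: (@le_trans _ _ (m i1)%:E); [rewrite lee_fin | exact: le_bigmax].
apply/eqP; rewrite eq_le V_le andbT devE; apply/bigmax_leP; split.
  exact: leNye.
by move=> i _; rewrite VE lee_fin.
Qed.
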